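(* Let $0<q<1$, let $\nu, c$ be real numbers with $\nu>1$, and let $\alpha=-\dfrac{\ln(q^{\nu}+q^{-\nu}-q^{-1})}{\ln q}$. Write $J(x)=J^{(2)}_\nu(x|q^2)$. Then, for $x>0$, $$\int\frac{x}{(-x^2(1-q)^2;q^2)_\infty}\Big(\frac{q^{-1}-q^{-\nu}[\nu]_q^2}{x}-\frac{c\,q^{-\nu}[\nu]_q^2}{x^2}+c+qx\Big)J(x)\,d_qx=\frac{x}{q(-x^2(1-q)^2;q^2)_\infty}\Big(J(x)-(c+x)D_{q^{-1}}J(x)\Big),$$ $$\int\frac{x}{(-x^2(1-q)^2;q^2)_\infty}\Big(\frac{q^{-1}-q^{-\nu}[\nu]_q^2}{x}+qx\Big)J(x)\,d_qx=\frac{x}{q(-x^2(1-q)^2;q^2)_\infty}\Big(J(x)-x\,D_{q^{-1}}J(x)\Big),$$ $$\int\frac{x^{\alpha+1}}{(-x^2(1-q)^2;q^2)_\infty}\Big(q+\frac{1-q^{1-\nu}[\nu]_q^2}{q\,x^2}\Big)J(x)\,d_qx=\frac{x^{\alpha+1}}{q^{\alpha}(-x^2(1-q)^2;q^2)_\infty}\Big(\frac{q^{1-\nu}(1-q)[\nu]_q^2-1}{x}J(x)-D_{q^{-1}}J(x)\Big).$$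
   Context: $[\nu]_q=\frac{1-q^\nu}{1-q}$ for real $\nu$; $(a;q)_k=\prod_{j=0}^{k-1}(1-aq^j)$, $(a;q)_\infty=\prod_{j\ge0}(1-aq^j)$, $(a,b;q)_k=(a;q)_k(b;q)_k$. For $x\neq0$, $D_qf(x)=\frac{f(x)-f(qx)}{(1-q)x}$ and $D_{q^{-1}}f(x)=\frac{f(x)-f(x/q)}{(1-q^{-1})x}$; the indefinite $q$-integral $\int f(x)\,d_qx=F(x)$ means $D_qF(x)=f(x)$. The second Jackson $q$-Bessel function is $J^{(2)}_\nu(z;q)=\frac{(q^{\nu+1};q)_\infty}{(q;q)_\infty}\sum_{n\ge0}\frac{(-1)^nq^{n(n+\nu)}}{(q,q^{\nu+1};q)_n}(z/2)^{2n+\nu}$, and $J^{(2)}_\nu(x|q^2):=J^{(2)}_\nu(2x(1-q);q^2)$, i.e. $$J^{(2)}_\nu(x|q^2)=\frac{(q^{2\nu+2};q^2)_\infty}{(q^2;q^2)_\infty}\sum_{n\ge0}\frac{(-1)^nq^{2n(n+\nu)}}{(q^2,q^{2\nu+2};q^2)_n}\big(x(1-q)\big)^{2n+\nu}.$$ *)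

(* Defs.v *)
From Stdlib Require Import Reals.
From Coquelicot Require Import Coquelicot.
Open Scope R_scope.

(* Real exponents are written with [Rpower], whose base is always positive
   where these definitions are used (0 < q < 1 and x > 0). *)

Definition qnum (q nu : R) : R := (1 - Rpower q nu) / (1 - q).

Fixpoint qpoch (a q : R) (k : nat) : R :=
  match k with
  | O => 1
  | S j => qpoch a q j * (1 - a * q ^ j)
  end.

(* The limit exists and is finite for every a when |q| < 1. *)
Definition qpoch_inf (a q : R) : R := real (Lim_seq (qpoch a q)).

Definition Dq (q : R) (f : R -> R) (x : R) : R :=
  (f x - f (q * x)) / ((1 - q) * x).

Definition Dq_inv (q : R) (f : R -> R) (x : R) : R :=
  (f x - f (x / q)) / ((1 - / q) * x).

(* F is an indefinite q-integral of f on the set I. *)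
Definition is_qintegral_on (I : R -> Prop) (q : R) (f F : R -> R) : Prop :=
  forall x : R, I x -> Dq q F x = f x.

Definition jackson2 (nu z q : R) : R :=
  qpoch_inf (Rpower q (nu + 1)) q / qpoch_inf q q *
  Series (fun n : nat =>
    (-1) ^ n * Rpower q (INR n * (INR n + nu))
      / (qpoch q q n * qpoch (Rpower q (nu + 1)) q n)
      * Rpower (z / 2) (2 * INR n + nu)).

(* The function written J_nu^(2)(x | q^2); the argument is q, not q^2. *)
Definition jackson2_sq (nu q x : R) : R :=
  jackson2 nu (2 * x * (1 - q)) (q ^ 2).

(* Main.v *)
Require Import Defs.
From Stdlib Require Import Reals Lra Lia.
From Coquelicot Require Import Coquelicot.
Open Scope R_scope.

(** The three-term recurrence of the coefficients of [J] is equivalent to the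
    q-difference equation
      [J (x/q) - (q^nu + q^-nu) J x + (1 + (1-q)^2 x^2) J (q x) = 0],
    and [E x = (1 + (1-q)^2 x^2) E (q x)].  In [F x - F (q x)] both relations
    eliminate [J (q x)]; the coefficient of [J (x/q)] then vanishes (for the third
    integral because [q^alpha = 1 / (q^nu + q^-nu - 1/q)]) and the coefficient of
    [J x] is the integrand. *)

(** * Shift relations for q-Pochhammer symbols and power series *)

Lemma qpoch_shift (a q : R) (k : nat) :
  qpoch a q (S k) = (1 - a) * qpoch (a * q) q k.
Proof.
  induction k as [|k IH].
  - simpl; ring.
  - change (qpoch a q (S k) * (1 - a * q ^ S k) =
            (1 - a) * (qpoch (a * q) q k * (1 - a * q * q ^ k))).
    rewrite IH; simpl; ring.
Qed.

(* No convergence is needed: [Lim_seq] is total and [real] sends infinities to 0. *)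
Lemma qpoch_inf_shift (a q : R) :
  qpoch_inf a q = (1 - a) * qpoch_inf (a * q) q.
Proof.
  unfold qpoch_inf.
  rewrite <- (Lim_seq_incr_1 (qpoch a q)).
  rewrite (Lim_seq_ext _ (fun k => (1 - a) * qpoch (a * q) q k))
    by (intros k; apply qpoch_shift).
  rewrite Lim_seq_scal_l.
  destruct (Lim_seq (qpoch (a * q) q)) as [l| |]; simpl; [reflexivity| |];
    destruct (Rle_dec 0 (1 - a)) as [h|h]; simpl; try ring;
    destruct (Rle_lt_or_eq_dec 0 (1 - a) h); simpl; ring.
Qed.

(** Since 1 - (1 + p) q^n + p q^(2n) = (1 - q^n)(1 - p q^n), the terms without the factor [q * x]
    combine to the coefficients on the left of [hrec]; the right side of [hrec] is what the term
    [p * (q * x)] contributes after an index shift. *)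
Lemma PSeries_q_difference (a : nat -> R) (p q x : R)
  (ha : forall y, ex_pseries a y)
  (hrec : forall n, a (S n) * ((1 - q ^ S n) * (1 - p * q ^ S n)) =
                    - (p * q ^ (2 * n + 1)) * a n) :
  PSeries a x - (1 + p) * PSeries a (q * x)
    + p * (1 + q * x) * PSeries a (q ^ 2 * x) = 0.
Proof.
  assert (ex : forall y, ex_series (fun n => a n * y ^ n))
    by (intros y; apply ex_pseries_R, ha).
  assert (exs : forall k y, ex_series (fun n => k * (a n * y ^ n)))
    by (intros k y; apply (ex_series_scal_l k (fun n => a n * y ^ n)), ex).
  set (d := fun n => a n * x ^ n - (1 + p) * (a n * (q * x) ^ n)
                     + p * (a n * (q ^ 2 * x) ^ n)).
  assert (exm : ex_series (fun n => a n * x ^ n - (1 + p) * (a n * (q * x) ^ n)))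
    by (apply (ex_series_minus (fun n => a n * x ^ n)); auto).
  assert (exd : ex_series d).
  { apply (ex_series_plus (fun n => a n * x ^ n - (1 + p) * (a n * (q * x) ^ n))
             (fun n => p * (a n * (q ^ 2 * x) ^ n))); auto. }
  assert (Hd : Series d = PSeries a x - (1 + p) * PSeries a (q * x)
                          + p * PSeries a (q ^ 2 * x)).
  { unfold d, PSeries.
    rewrite Series_plus by auto.
    rewrite Series_minus by auto.
    now rewrite !Series_scal_l. }
  assert (Hs : Series d = - (p * q * x) * PSeries a (q ^ 2 * x)).
  { rewrite (Series_incr_1 d exd).
    unfold PSeries; rewrite <- Series_scal_l.
    rewrite (Series_ext _ (fun n => - (p * q * x) * (a n * (q ^ 2 * x) ^ n))).
    - unfold d; simpl; ring.
    - intros n.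
      transitivity (a (S n) * ((1 - q ^ S n) * (1 - p * q ^ S n)) * x ^ S n).
      + unfold d; rewrite !Rpow_mult_distr, <- pow_mult, Nat.mul_comm, pow_mult.
        ring.
      + rewrite hrec, Rpow_mult_distr, <- pow_mult, pow_add.
        simpl; ring. }
  rewrite Hs in Hd; lra.
Qed.

(** * Coefficients of the Jackson function and convergence *)

Lemma Rpower_in_unit (q s : R) : 0 < q < 1 -> 0 < s -> 0 < Rpower q s < 1.
Proof.
  intros hq hs; split; [apply exp_pos|].
  rewrite <- (Rpower_O q) by lra.
  unfold Rpower; apply exp_increasing.
  assert (ln q < 0) by (rewrite <- ln_1; apply ln_increasing; lra).
  nra.
Qed.

Lemma one_minus_mul_pow_ge (a q : R) (n : nat) :
  0 < a < 1 -> 0 < q < 1 -> 1 - a <= 1 - a * q ^ n.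
Proof.
  intros ha hq.
  assert (q ^ n <= 1) by (rewrite <- (pow1 n); apply pow_incr; lra).
  nra.
Qed.

Lemma qpoch_pos (a q : R) (n : nat) :
  0 < a < 1 -> 0 < q < 1 -> 0 < qpoch a q n.
Proof.
  intros ha hq; induction n as [|n IH]; simpl; [lra|].
  apply Rmult_lt_0_compat; [exact IH|].
  pose proof (one_minus_mul_pow_ge a q n ha hq); lra.
Qed.

(** With (z/2)^nu and the constant prefactor taken out, [jackson2] is the power series in (z/2)^2
    with these coefficients. *)
Definition jackson2_coef (nu q : R) (n : nat) : R :=
  (-1) ^ n * Rpower q (INR n * (INR n + nu))
    / (qpoch q q n * qpoch (Rpower q (nu + 1)) q n).

Lemma jackson2_coef_neq0 (nu q : R) (n : nat) :
  0 < q < 1 -> -1 < nu -> jackson2_coef nu q n <> 0.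
Proof.
  intros hq hnu.
  assert (hb := Rpower_in_unit q (nu + 1) hq ltac:(lra)).
  assert (h1 := qpoch_pos q q n hq hq).
  assert (h2 := qpoch_pos _ q n hb hq).
  assert (h3 : (-1) ^ n <> 0) by (apply pow_nonzero; lra).
  assert (h4 : 0 < Rpower q (INR n * (INR n + nu))) by apply exp_pos.
  unfold jackson2_coef, Rdiv.
  apply Rmult_integral_contrapositive_currified.
  - apply Rmult_integral_contrapositive_currified; lra.
  - apply Rinv_neq_0_compat, Rgt_not_eq, Rmult_lt_0_compat; assumption.
Qed.

(** The exponent of q grows by (n+1)(n+1+nu) - n(n+nu) = 2n+1+nu, and each q-Pochhammer symbol gains
    one factor. The form is that of [hrec] with p = q^nu. *)
Lemma jackson2_coef_rec (nu q : R) (n : nat) :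
  0 < q < 1 -> -1 < nu ->
  jackson2_coef nu q (S n) *
    ((1 - q ^ S n) * (1 - Rpower q nu * q ^ S n)) =
  - (Rpower q nu * q ^ (2 * n + 1)) * jackson2_coef nu q n.
Proof.
  intros hq hnu.
  assert (hb := Rpower_in_unit q (nu + 1) hq ltac:(lra)).
  assert (h1 := qpoch_pos q q n hq hq).
  assert (h2 := qpoch_pos _ q n hb hq).
  assert (h3 := one_minus_mul_pow_ge q q n hq hq).
  assert (h4 := one_minus_mul_pow_ge _ q n hb hq).
  assert (hpow : Rpower q (INR (S n) * (INR (S n) + nu)) =
    Rpower q (INR n * (INR n + nu)) * (Rpower q nu * q ^ (2 * n + 1))).
  { rewrite <- Rpower_pow by lra.
    rewrite <- !Rpower_plus; f_equal.
    rewrite S_INR, plus_INR, mult_INR; simpl; ring. }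
  assert (hbq : Rpower q nu * q ^ S n = Rpower q (nu + 1) * q ^ n).
  { rewrite Rpower_plus, Rpower_1 by lra; simpl; ring. }
  unfold jackson2_coef; rewrite hpow, hbq; simpl qpoch; simpl pow.
  field; repeat split; lra.
Qed.

(** Ratio test: by the recurrence, consecutive coefficients have a quotient of order q^(2n), so the
    radius of convergence is infinite. *)
Lemma jackson2_coef_ex_pseries (nu q x : R) :
  0 < q < 1 -> -1 < nu -> ex_pseries (jackson2_coef nu q) x.
Proof.
  intros hq hnu.
  assert (hb := Rpower_in_unit q (nu + 1) hq ltac:(lra)).
  apply CV_radius_inside.
  rewrite CV_radius_infinite_DAlembert; [exact I| |].
  - intros n; now apply jackson2_coef_neq0.
  (* Both denominator factors are smallest at n = 0, and one of the two factors q^n in the numerator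
     is bounded by 1; this gives [M * q ^ n]. *)
  - set (M := Rpower q nu * q / ((1 - q) * (1 - Rpower q (nu + 1)))).
    apply is_lim_seq_le_le with (fun _ => 0) (fun n => M * q ^ n).
    + intros n; split; [apply Rabs_pos|].
      assert (hn := jackson2_coef_neq0 nu q n hq hnu).
      assert (hrec := jackson2_coef_rec nu q n hq hnu).
      assert (h3 := one_minus_mul_pow_ge q q n hq hq).
      assert (h4 := one_minus_mul_pow_ge _ q n hb hq).
      assert (hbq : Rpower q nu * q ^ S n = Rpower q (nu + 1) * q ^ n).
      { rewrite Rpower_plus, Rpower_1 by lra; simpl; ring. }
      rewrite hbq in hrec; change (q ^ S n) with (q * q ^ n) in hrec.
      assert (hp : 0 < Rpower q nu) by apply exp_pos.
      assert (hqn : 0 < q ^ n) by (apply pow_lt; lra).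
      assert (hqn1 : q ^ n <= 1) by (rewrite <- (pow1 n); apply pow_incr; lra).
      set (D := (1 - q * q ^ n) * (1 - Rpower q (nu + 1) * q ^ n)) in *.
      assert (hD : (1 - q) * (1 - Rpower q (nu + 1)) <= D)
        by (apply Rmult_le_compat; lra).
      assert (hD0 : 0 < (1 - q) * (1 - Rpower q (nu + 1)))
        by (apply Rmult_lt_0_compat; lra).
      replace (jackson2_coef nu q (S n) / jackson2_coef nu q n)
        with (- (Rpower q nu * q ^ (2 * n + 1) / D)).
      2:{ apply Rmult_eq_reg_r with (jackson2_coef nu q n * D).
          2:{ apply Rmult_integral_contrapositive_currified; lra. }
          transitivity (- (Rpower q nu * q ^ (2 * n + 1)) * jackson2_coef nu q n).
          - field; lra.
          - rewrite <- hrec; field; exact hn. }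
      assert (hnum : q ^ (2 * n + 1) = q * q ^ n * q ^ n)
        by (replace (2 * n + 1)%nat with (S (n + n)) by lia;
            simpl; rewrite pow_add; ring).
      rewrite Rabs_Ropp, hnum, Rabs_pos_eq.
      2:{ apply Rmult_le_pos; [|left; apply Rinv_0_lt_compat; lra].
          repeat apply Rmult_le_pos; lra. }
      unfold M, Rdiv.
      replace (Rpower q nu * q * / ((1 - q) * (1 - Rpower q (nu + 1))) * q ^ n)
        with (Rpower q nu * (q * q ^ n * 1) * / ((1 - q) * (1 - Rpower q (nu + 1))))
        by ring.
      apply Rmult_le_compat.
      * repeat apply Rmult_le_pos; lra.
      * left; apply Rinv_0_lt_compat; lra.
      * repeat apply Rmult_le_compat_l; try lra.
        apply Rmult_le_pos; lra.
      * apply Rinv_le_contravar; lra.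
    + apply is_lim_seq_const.
    + replace (Finite 0) with (Rbar_mult M 0) by (simpl; f_equal; ring).
      apply is_lim_seq_scal_l, is_lim_seq_geom.
      rewrite Rabs_pos_eq; lra.
Qed.

(** * The q-difference equation of the Jackson function *)

Lemma jackson2_PSeries (nu z q : R) : 0 < z ->
  jackson2 nu z q =
  qpoch_inf (Rpower q (nu + 1)) q / qpoch_inf q q *
    (Rpower (z / 2) nu * PSeries (jackson2_coef nu q) ((z / 2) ^ 2)).
Proof.
  intros hz; unfold jackson2, PSeries.
  f_equal; rewrite <- Series_scal_l.
  apply Series_ext; intros n; fold (jackson2_coef nu q n).
  rewrite Rpower_plus, <- pow_mult, <- Rpower_pow, mult_INR by lra.
  replace (INR 2) with 2 by (simpl; ring); ring.
Qed.

(** In base q^2 with p = q^(2 nu), the series at y = (z/(2q))^2, q^2 y and q^4 y belong to the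
    arguments z/q, z and q z. Their prefactors are in ratio 1 : q^nu : q^(2 nu), which turns 1 + p
    into q^nu + q^(-nu) and absorbs the p of the last term. *)
Lemma jackson2_q_difference (nu z q : R) :
  0 < q < 1 -> -1 < nu -> 0 < z ->
  jackson2 nu (z / q) (q ^ 2)
    - (Rpower q nu + Rpower q (- nu)) * jackson2 nu z (q ^ 2)
    + (1 + z ^ 2 / 4) * jackson2 nu (q * z) (q ^ 2) = 0.
Proof.
  intros hq hnu hz.
  assert (hq2 : 0 < q ^ 2 < 1) by (simpl; nra).
  assert (hzq : 0 < z / q) by (apply Rdiv_lt_0_compat; lra).
  assert (hp : 0 < Rpower q nu) by apply exp_pos.
  assert (hpp : Rpower (q ^ 2) nu = Rpower q nu ^ 2).
  { simpl; rewrite !Rmult_1_r; symmetry; apply Rpower_mult_distr; lra. }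
  assert (H := PSeries_q_difference (jackson2_coef nu (q ^ 2)) (Rpower (q ^ 2) nu)
    (q ^ 2) ((z / q / 2) ^ 2)
    (fun y => jackson2_coef_ex_pseries nu (q ^ 2) y hq2 hnu)
    (fun n => jackson2_coef_rec nu (q ^ 2) n hq2 hnu)).
  rewrite !jackson2_PSeries by nra.
  rewrite hpp in H.
  replace (q ^ 2 * (z / q / 2) ^ 2) with ((z / 2) ^ 2) in H by (field; lra).
  replace ((q ^ 2) ^ 2 * (z / q / 2) ^ 2) with ((q * z / 2) ^ 2) in H by (field; lra).
  replace (Rpower (z / 2) nu) with (Rpower q nu * Rpower (z / q / 2) nu).
  2:{ rewrite Rpower_mult_distr by lra; f_equal; field; lra. }
  replace (Rpower (q * z / 2) nu) with (Rpower q nu ^ 2 * Rpower (z / q / 2) nu).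
  2:{ rewrite <- hpp, Rpower_mult_distr by lra; f_equal; field; lra. }
  rewrite Rpower_Ropp.
  set (K := _ / _).
  transitivity (K * Rpower (z / q / 2) nu * 0); [rewrite <- H; field; lra | ring].
Qed.

(** * The three q-integrals *)

Theorem theorem2p5 (q nu c alpha : R)
  (hq0 : 0 < q) (hq1 : q < 1) (hnu : 1 < nu)
  (halpha : alpha = - (ln (Rpower q nu + Rpower q (- nu) - / q) / ln q)) :
  let J := jackson2_sq nu q in
  let E := fun x : R => qpoch_inf (- (x ^ 2 * (1 - q) ^ 2)) (q ^ 2) in
  is_qintegral_on (fun x => 0 < x) q
    (fun x => x / E x *
       ((/ q - Rpower q (- nu) * qnum q nu ^ 2) / x
        - c * Rpower q (- nu) * qnum q nu ^ 2 / x ^ 2 + c + q * x) * J x)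
    (fun x => x / (q * E x) * (J x - (c + x) * Dq_inv q J x))
  /\
  is_qintegral_on (fun x => 0 < x) q
    (fun x => x / E x *
       ((/ q - Rpower q (- nu) * qnum q nu ^ 2) / x + q * x) * J x)
    (fun x => x / (q * E x) * (J x - x * Dq_inv q J x))
  /\
  is_qintegral_on (fun x => 0 < x) q
    (fun x => Rpower x (alpha + 1) / E x *
       (q + (1 - Rpower q (1 - nu) * qnum q nu ^ 2) / (q * x ^ 2)) * J x)
    (fun x => Rpower x (alpha + 1) / (Rpower q alpha * E x) *
       ((Rpower q (1 - nu) * (1 - q) * qnum q nu ^ 2 - 1) / x * J x
        - Dq_inv q J x)).
Proof.
  intros J E.
  assert (hp := Rpower_in_unit q nu ltac:(lra) ltac:(lra)).
  (* This uses nu > 1; it yields q^(-nu) > 1/q, so the argument of the logarithm in [alpha] is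
     positive. *)
  assert (hp1 : Rpower q nu < q).
  { assert (h := Rpower_in_unit q (nu - 1) ltac:(lra) ltac:(lra)).
    replace nu with (nu - 1 + 1) by ring.
    rewrite Rpower_plus, Rpower_1 by lra; nra. }
  assert (hm : Rpower q (- nu) = / Rpower q nu) by apply Rpower_Ropp.
  assert (hm1 : Rpower q (1 - nu) = q / Rpower q nu).
  { unfold Rminus; rewrite Rpower_plus, Rpower_1, hm by lra; reflexivity. }
  assert (hqp : / q < / Rpower q nu) by (apply Rinv_lt_contravar; nra).
  assert (hal : Rpower q alpha = / (Rpower q nu + / Rpower q nu - / q)).
  { rewrite halpha, hm; unfold Rpower at 1.
    rewrite <- (exp_ln (Rpower q nu + / Rpower q nu - / q)) at 2 by lra.
    rewrite <- exp_Ropp; f_equal; field.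
    assert (ln q < ln 1) by (apply ln_increasing; lra).
    rewrite ln_1 in *; lra. }
  (* Splitting off the first factor multiplies the parameter by the base q^2, which amounts to
     replacing x by q x. *)
  assert (hE : forall x, E x = (1 + x ^ 2 * (1 - q) ^ 2) * E (q * x)).
  { intros x; unfold E; rewrite qpoch_inf_shift; f_equal; [ring|f_equal; ring]. }
  assert (ht : forall x, 0 < 1 + x ^ 2 * (1 - q) ^ 2).
  { intros x; rewrite <- Rpow_mult_distr.
    pose proof (pow2_ge_0 (x * (1 - q))); lra. }
  assert (hJ : forall x, 0 < x ->
    J (q * x) = ((Rpower q nu + / Rpower q nu) * J x - J (x / q))
                / (1 + x ^ 2 * (1 - q) ^ 2)).
  { intros x hx.
    assert (h := jackson2_q_difference nu (2 * x * (1 - q)) q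
                   ltac:(lra) ltac:(lra) ltac:(nra)).
    rewrite hm in h.
    assert (htx := ht x).
    unfold J, jackson2_sq.
    replace (2 * (q * x) * (1 - q)) with (q * (2 * x * (1 - q))) by ring.
    replace (2 * (x / q) * (1 - q)) with (2 * x * (1 - q) / q) by (field; lra).
    apply Rmult_eq_reg_r with (1 + x ^ 2 * (1 - q) ^ 2); [|lra].
    transitivity ((Rpower q nu + / Rpower q nu) * jackson2 nu (2 * x * (1 - q)) (q ^ 2)
      - jackson2 nu (2 * x * (1 - q) / q) (q ^ 2)); [|field; lra].
    replace ((2 * x * (1 - q)) ^ 2 / 4) with (x ^ 2 * (1 - q) ^ 2) in h by field.
    lra. }
  (* Taken for every constant, because the second integral is the case c' = 0. *)
  assert (first : forall c', is_qintegral_on (fun x => 0 < x) q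
    (fun x => x / E x *
       ((/ q - Rpower q (- nu) * qnum q nu ^ 2) / x
        - c' * Rpower q (- nu) * qnum q nu ^ 2 / x ^ 2 + c' + q * x) * J x)
    (fun x => x / (q * E x) * (J x - (c' + x) * Dq_inv q J x))).
  { intros c' x hx.
    assert (htx := ht x).
    unfold Dq, Dq_inv, qnum.
    (* [Dq_inv q J (q * x)] evaluates J at q x and x, so only J at x/q, x and q x occurs. *)
    replace (q * x / q) with x by (field; lra).
    rewrite hE, (hJ x hx), hm.
    (* The identity is linear in the common factor [/ E (q * x)], so it holds with an arbitrary real
       [e] in its place. *)
    unfold Rdiv; rewrite !Rinv_mult; generalize (/ E (q * x)); intros e.
    field; repeat split; lra. }
  split; [apply first|split].
  - intros x hx; generalize (first 0 x hx); unfold Dq.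
    rewrite !Rplus_0_l; intros ->.
    unfold Rdiv; generalize (/ E x); intros e; field; lra.
  - intros x hx.
    assert (htx := ht x).
    unfold Dq, Dq_inv, qnum.
    replace (q * x / q) with x by (field; lra).
    (* Passing from x to q x releases q^(alpha+1), whose value is known from [hal]. *)
    rewrite <- (Rpower_mult_distr q x) by lra.
    rewrite !Rpower_plus, !Rpower_1 by lra.
    rewrite hE, (hJ x hx), hm1, hal.
    unfold Rdiv; rewrite !Rinv_mult, !Rinv_inv; generalize (/ E (q * x)); intros e.
    (* With p = q^nu, the numerator of p + 1/p - 1/q is p^2 q + q - p, positive by this bound and
       [hp1]. *)
    assert (0 < Rpower q nu * Rpower q nu * q) by (repeat apply Rmult_lt_0_compat; lra).
    field; repeat split; lra.
Qed.
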